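(* Assume that $\lambda(t)=\frac{K}{(1+t)^{\alpha}}$ for $t\ge0$, where $K>0$ and $0<\alpha<1$ are constants, and that there exist $\kappa>0$ and $\theta\in(0,\tfrac12]$ such that $$\big(f(x)-f_Q^*\big)^{\theta}\ \ge\ \kappa\,\mathrm{dist}\big(x,\arg\min_Q f\big)\qquad\text{for all }x\in Q.$$ Then for every $x_0\in Q$, the unique solution $x\in C^1([0,+\infty),\mathcal{H})$ of $$x'(t)+x(t)=P_Q\big(x(t)-\lambda(t)\nabla f(x(t))\big),\quad t\ge 0,\qquad x(0)=x_0,$$ converges strongly as $t\to+\infty$ to some $x_\infty\in\arg\min_Q f$, and, as $t\to+\infty$: if $\theta\in(0,\tfrac12)$, $$\|x(t)-x_\infty\|=O\Big(t^{-\frac{(1-\alpha)\theta}{1-2\theta}}\Big),\qquad f(x(t))-f_Q^*=O\Big(t^{-\frac{1-\alpha}{1-2\theta}}\Big);$$ if $\theta=\tfrac12$, there is a constant $\delta>0$ such that $$\|x(t)-x_\infty\|=O\big(e^{-\delta\Gamma(t)}\big),\qquad f(x(t))-f_Q^*=O\big(e^{-\delta\Gamma(t)}\big),$$ where $\Gamma(t)=\int_0^t\lambda(s)\,ds$.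
   Context: $\mathcal{H}$ is a real Hilbert space with inner product $\langle\cdot,\cdot\rangle$ and norm $\|\cdot\|$. $Q$ is a closed, convex, non-empty subset of $\mathcal{H}$, and $P_Q:\mathcal{H}\to Q$ is the (metric) projection onto $Q$. $f:\mathcal{H}\to\mathbb{R}$ is a $C^1$ convex function whose gradient $\nabla f$ is locally Lipschitz on $\mathcal{H}$. It is assumed that $f$ attains its minimum over $Q$: with $f_Q^*:=\min_Q f$, the set $\arg\min_Q f:=\{x\in Q: f(x)=f_Q^*\}$ is non-empty. $\mathrm{dist}(x,S)=\inf_{y\in S}\|x-y\|$. Under these standing assumptions, for every $x_0\in Q$ the Cauchy problem $x'(t)+x(t)=P_Q\big(x(t)-\lambda(t)\nabla f(x(t))\big)$, $t\ge 0$, $x(0)=x_0$, with $\lambda(t)=\frac{K}{(1+t)^{\alpha}}$, has a unique global solution $x\in C^1([0,+\infty),\mathcal{H})$, and it stays in $Q$. *)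

(* Defs.v *)
From HB Require Import structures.
From mathcomp Require Import all_boot all_order all_algebra sesquilinear.
From mathcomp Require Import all_classical all_reals all_analysis.

Set Implicit Arguments.
Unset Strict Implicit.
Unset Printing Implicit Defensive.

Import Order.TTheory GRing.Theory Num.Theory.
Import numFieldNormedType.Exports.

Local Open Scope classical_set_scope.
Local Open Scope ring_scope.

(* Lets the library's Landau notation [=O_] be used at the filter [+oo]. *)
Canonical pinfty_filter_on (R : realType) := FilterType (pinfty_nbhs R) _.

(* A real Hilbert space is a complete normed module whose norm is the one
   induced by a (symmetric, positive definite) inner product. *)
Definition hilbert_norm (R : realType) (H : completeNormedModType R)
    (dot : {dot H for @idfun R}) : Prop :=
  forall u : H, `|u| ^+ 2 = dot u u.

(* The Riesz representative of the Frechet differential. *)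
Definition gradient (R : realType) (H : completeNormedModType R)
    (dot : {dot H for @idfun R}) (f : H -> R) (x : H) : H :=
  get [set g : H | forall h : H, 'd f x h = dot g h].

Definition metric_projection (R : realType) (H : completeNormedModType R)
    (Q : set H) (x : H) : H :=
  get [set p : H | Q p /\ forall y : H, Q y -> `|x - p| <= `|x - y|].

Definition dist (R : realType) (H : completeNormedModType R)
    (x : H) (S : set H) : R :=
  inf [set `|x - y| | y in S].

Definition locally_lipschitz (R : realType) (H : completeNormedModType R)
    (g : H -> H) : Prop :=
  forall x : H, exists2 U : set H, nbhs x U & [lipschitz g y | y in U].

Definition attains_min (R : realType) (H : completeNormedModType R)
    (Q : set H) (f : H -> R) : Prop :=
  exists2 x : H, Q x & forall y : H, Q y -> f x <= f y.

(* This [inf] is the minimum of [f] over [Q] as soon as [attains_min Q f]; when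
   [f] is not bounded below on [Q] it is a junk value. *)
Definition min_val (R : realType) (H : completeNormedModType R)
    (Q : set H) (f : H -> R) : R :=
  inf [set f x | x in Q].

Definition argmin (R : realType) (H : completeNormedModType R)
    (Q : set H) (f : H -> R) : set H :=
  [set x : H | Q x /\ f x = min_val Q f].

Definition lambda (R : realType) (K alpha t : R) : R := K / (1 + t) `^ alpha.

Definition Gamma (R : realType) (K alpha t : R) : R :=
  \int[lebesgue_measure]_(s in `[0, t]) lambda K alpha s.

(* [x] is of class C^1 on [0, +oo[ with derivative [dx]; the derivative at [0]
   is one-sided, and values of [x] and [dx] at negative times are irrelevant. *)
Definition C1_half_line (R : realType) (H : completeNormedModType R)
    (x dx : R -> H) : Prop :=
  (forall t : R, 0 <= t ->
     (s - t)^-1 *: (x s - x t) @[s --> within `[0, +oo[ t^'] --> dx t) /\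
  {within `[0, +oo[, continuous dx}.

Definition cauchy_solution (R : realType) (H : completeNormedModType R)
    (dot : {dot H for @idfun R}) (Q : set H) (f : H -> R) (K alpha : R)
    (x0 : H) (x : R -> H) : Prop :=
  x 0 = x0 /\
  exists dx : R -> H,
    C1_half_line x dx /\
    forall t : R, 0 <= t ->
      dx t + x t =
      metric_projection Q (x t - lambda K alpha t *: gradient dot f (x t)).

(* Main.v *)
Require Import Defs.
From HB Require Import structures.
From mathcomp Require Import all_boot all_order all_algebra sesquilinear ring lra.
From mathcomp Require Import all_classical all_reals all_analysis.
Set Implicit Arguments.
Unset Strict Implicit.
Unset Printing Implicit Defensive.
Import Order.TTheory GRing.Theory Num.Theory.
Import numFieldNormedType.Exports.
Local Open Scope classical_set_scope.
Local Open Scope ring_scope.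

(* Write F(t) = f(x(t)) - min_Q f, v = |x'|, g = grad f(x(t)).  Since x' + x is
   the projection of x - lambda g, <x' + lambda g, z - x - x'> >= 0 for every z
   in Q.  Taking z = x(t) gives v^2 <= lambda (-F'); taking z in argmin_Q f and
   using convexity gives lambda F <= v dist(x, argmin_Q f) + lambda (-F').  With
   the error bound these two inequalities imply -F' >= c lambda F^(2 - 2 theta),
   which integrates to the decay rates of F.  They also imply
   v <= C (- d/dt F^theta), so the trajectory has finite length and
   |x(t) - x_oo| <= C F(t)^theta.  If F vanishes at some time, the trajectory is
   constant from then on. *)

(** * Inner product algebra and the Cauchy-Schwarz inequality *)

Section InnerProduct.
Context {R : realType} {H : completeNormedModType R} (dot : {dot H for @idfun R}).
Hypothesis dotE : hilbert_norm dot.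

Lemma dotC u v : dot u v = dot v u.
Proof. by rewrite hermC expr0 mul1r. Qed.

Lemma dotDl u v w : dot (u + v) w = dot u w + dot v w.
Proof. exact: linearDl. Qed.

Lemma dotDr u v w : dot w (u + v) = dot w u + dot w v.
Proof. exact: linearDr. Qed.

Lemma dotNl u w : dot (- u) w = - dot u w.
Proof. exact: linearNl. Qed.

Lemma dotNr u w : dot w (- u) = - dot w u.
Proof. exact: linearNr. Qed.

Lemma dotZr a u w : dot w (a *: u) = a * dot w u.
Proof. exact: linearZr_LR. Qed.

Lemma dotZl a u w : dot (a *: u) w = a * dot u w.
Proof. by rewrite dotC dotZr dotC. Qed.

Definition dotl := (dotDl, dotDr, dotNl, dotNr, dotZl, dotZr).

(** With a = |u| and b = |v|, expanding the square of the norm of b u - a v gives 2ab(ab - <u, v>),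
    which is therefore nonnegative. *)
Lemma dot_le_norm u v : dot u v <= `|u| * `|v|.
Proof.
have [->|u0] := eqVneq u 0.
  by rewrite -[0](scale0r 0) dotZl mul0r mulr_ge0.
have [->|v0] := eqVneq v 0.
  by rewrite -[0](scale0r 0) dotZr mul0r mulr_ge0.
have := sqr_ge0 `| `|v| *: u - `|u| *: v|.
rewrite dotE !dotl -!dotE (dotC v u).
have : 0 < `|u| * `|v| by rewrite mulr_gt0 ?normr_gt0.
move: `|u| `|v| (dot u v) => a b c ab0.
rewrite [X in 0 <= X -> _](_ : _ = 2 * (a * b) * (a * b - c)); last by ring.
by rewrite pmulr_rge0 ?subr_ge0// mulr_gt0.
Qed.

Lemma normr_dot u v : `|dot u v| <= `|u| * `|v|.
Proof.
rewrite ler_norml dot_le_norm andbT lerNl -dotNl.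
by rewrite (le_trans (dot_le_norm _ _))// normrN.
Qed.

Lemma cvg_dotr (T : Type) (F : set_system T) {FF : Filter F} (g : T -> H) l u :
  g @ F --> l -> (fun t => dot u (g t)) @ F --> dot u l.
Proof.
move=> gl; apply/cvgrPdist_le => e e0.
have u1 : 0 < `|u| + 1 by rewrite ltr_wpDl.
have e1 : 0 < e / (`|u| + 1) by rewrite divr_gt0.
move/cvgrPdist_le : gl => /(_ _ e1); apply: filterS => t gt.
rewrite -dotNr -dotDr (le_trans (normr_dot _ _))//.
rewrite (le_trans (ler_wpM2l _ gt))//.
by rewrite mulrCA ler_piMr ?ltW// ltr_pdivrMr// mul1r ltrDl.
Qed.

Lemma parallelogram (u v : H) :
  `|u - v| ^+ 2 = 2 * `|u| ^+ 2 + 2 * `|v| ^+ 2 - 4 * `|2^-1 *: (u + v)| ^+ 2.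
Proof.
by rewrite !dotE !dotl (dotC v u); field.
Qed.

End InnerProduct.

(** * Metric projection onto a closed convex set *)

Lemma convex_set_segment (R : realType) (H : lmodType R) (Q : set H) (a b : H) (t : R) :
  convex_set Q -> Q a -> Q b -> 0 <= t <= 1 -> Q (b + t *: (a - b)).
Proof.
move=> cQ Qa Qb /andP[t0 t1].
have tP : Itv.spec (@Itv.num_sem R) (Itv.Real `[0%Z, 1%Z]%R) t.
  by rewrite /= /Itv.num_sem num_real/= in_itv/= t0 t1.
have := cQ a b (Itv.mk tP); rewrite !inE => /(_ Qa Qb).
rewrite /conv/= scalerBl scale1r scalerBr; congr Q.
by rewrite addrCA addrA.
Qed.

Section Projection.
Context {R : realType} {H : completeNormedModType R} (dot : {dot H for @idfun R}).
Hypothesis dotE : hilbert_norm dot.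
Variable Q : set H.
Hypotheses (clQ : closed Q) (cvQ : convex_set Q) (Q0 : Q !=set0).

(** Take a minimizing sequence whose squared distances to x are within 1/(n+1) of the infimum.
    Midpoints stay in [Q], so the parallelogram law bounds |y n - y m|^2 by 2/(n+1) + 2/(m+1). The
    sequence is Cauchy, and its limit lies in the closed set [Q]. *)
Lemma exists_nearest_point (x : H) :
  exists p, Q p /\ forall y, Q y -> `|x - p| <= `|x - y|.
Proof.
pose S : set R := [set `|x - y| ^+ 2 | y in Q].
have S0 : S !=set0 by case: Q0 => q Qq; exists (`|x - q| ^+ 2), q.
have infS : has_inf S.
  by split => //; exists 0 => _ [y _ <-]; exact: sqr_ge0.
have lbS y : Q y -> inf S <= `|x - y| ^+ 2.
  by move=> Qy; apply: ge_inf; [exact: infS.2|exists y].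
have /choice[y yP] (n : nat) : exists y, Q y /\ `|x - y| ^+ 2 < inf S + n.+1%:R^-1.
  have n0 : 0 < n.+1%:R^-1 :> R by rewrite invr_gt0.
  by have [_ [y Qy <-] ylt] := inf_adherent n0 infS; exists y.
have yC n m : `|y n - y m| ^+ 2 <= 2 * n.+1%:R^-1 + 2 * m.+1%:R^-1.
  have -> : y n - y m = (x - y m) - (x - y n) by rewrite opprB [RHS]addrC addrA subrK.
  rewrite (parallelogram dotE).
  have -> : 2^-1 *: (x - y m + (x - y n)) = x - (y m + 2^-1 *: (y n - y m)).
    have -> : x - y m + (x - y n) = 2 *: (x - (y m + 2^-1 *: (y n - y m))).
      rewrite scalerBr scalerDr scalerA mulfV ?pnatr_eq0// scale1r.
      rewrite !scaler_nat !mulr2n addrACA -opprD; congr (_ - _).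
      by rewrite [RHS]addrC addrA subrK addrC.
    by rewrite scalerA mulVf ?pnatr_eq0// scale1r.
  have Qm : Q (y m + 2^-1 *: (y n - y m)).
    by apply: convex_set_segment => //; [exact: (yP n).1|exact: (yP m).1|apply/andP; split; lra].
  have := lbS _ Qm; have := (yP n).2; have := (yP m).2.
  have aux (a b c d i j : R) : a < d + i -> b < d + j -> d <= c ->
    2 * a + 2 * b - 4 * c <= 2 * j + 2 * i by lra.
  exact: aux.
have yc : cauchy_ex (y @ \oo).
  move=> e e0; have e4 : 0 < e ^+ 2 / 4 by rewrite divr_gt0// exprn_gt0.
  have [N _ Ne] := near_infty_natSinv_lt (PosNum e4).
  exists (y N); exists N => // n /= Nn; rewrite -ball_normE /=.
  rewrite -(@ltr_pXn2r _ 2)// ?nnegrE ?normr_ge0 ?ltW//.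
  apply: (le_lt_trans (yC _ _)).
  have aux (a b c : R) : a < c / 4 -> b < c / 4 -> 2 * a + 2 * b < c by lra.
  exact: (aux _ _ _ (Ne _ (leqnn N)) (Ne _ Nn)).
have /cauchy_exP/cauchy_cvgP/cvg_ex[p yp] := yc.
exists p; split.
  apply: (closed_cvg _ clQ _ _ yp).
  by apply: nearW => n; exact: (yP n).1.
move=> z Qz; rewrite -(@ler_pXn2r _ 2)// ?nnegrE//.
apply: le_trans (lbS _ Qz).
have l1 : `|x - y n| ^+ 2 @[n --> \oo] --> `|x - p| ^+ 2.
  rewrite expr2; under eq_fun do rewrite expr2.
  by apply: cvgM; apply: cvg_norm; apply: cvgB => //; exact: cvg_cst.
have l2 : inf S + n.+1%:R^-1 @[n --> \oo] --> inf S.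
  rewrite -[X in _ --> X]addr0; apply: cvgD; first exact: cvg_cst.
  exact: cvg_harmonic.
rewrite -(cvg_lim _ l1)// -(cvg_lim _ l2)//; apply: ler_lim.
- by apply/cvg_ex; eexists; exact: l1.
- by apply/cvg_ex; eexists; exact: l2.
- by apply: nearW => n; exact/ltW/(yP n).2.
Qed.

Lemma projection_in x : Q (metric_projection Q x).
Proof. by have [] := getPex (exists_nearest_point x). Qed.

Lemma projection_le x y : Q y -> `|x - metric_projection Q x| <= `|x - y|.
Proof. by move=> Qy; have [_ ->] := getPex (exists_nearest_point x). Qed.

(** Moving from p towards z by a fraction s stays in [Q]. Minimality of |x - p| then gives 2 <x - p,
    z - p> <= s |z - p|^2 for all small s. *)
Lemma projection_variational x z : Q z ->
  dot (x - metric_projection Q x) (z - metric_projection Q x) <= 0.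
Proof.
move=> Qz; set p := metric_projection Q x.
have Hs (s : R) : 0 < s <= 1 -> 2 * dot (x - p) (z - p) <= s * `|z - p| ^+ 2.
  move=> /andP[s0 s1].
  have Qs : Q (p + s *: (z - p)).
    by apply: convex_set_segment => //; [exact: projection_in|rewrite ltW].
  have : `|x - p| ^+ 2 <= `|x - (p + s *: (z - p))| ^+ 2.
    by rewrite ler_pXn2r ?nnegrE//; exact: projection_le.
  rewrite opprD addrA !dotE.
  move: (x - p) (z - p) => u v.
  rewrite !(dotl dot) (dotC _ v u) => h.
  rewrite -(ler_pM2l s0). lra.
rewrite leNgt; apply/negP => d0.
move: Hs d0; move: (dot _ _) (`|_| ^+ 2) (sqr_ge0 `|z - p|) => d n n0 Hs d0.
have nd : 0 < d + n by rewrite ltr_wpDr.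
(* Instead of a limit s -> 0, one value suffices: if d > 0, then s = d/(d+n) satisfies s n <= d, so
   2d <= d, a contradiction. *)
have /Hs : 0 < d / (d + n) <= 1.
  by rewrite divr_gt0//= ler_pdivrMr// mul1r lerDl.
suff : d / (d + n) * n <= d by lra.
rewrite mulrAC ler_pdivrMr//; nra.
Qed.

End Projection.

(** * Riesz representation, the gradient and convexity *)

(** For nonzero L, let p be the point of the closed convex set {L = 1} nearest to 0. The variational
    inequality at p + h and p - h, with L h = 0, shows that p is orthogonal to the kernel. Since h -
    (L h) p is in the kernel, p / |p|^2 represents L. *)
Lemma riesz (R : realType) (H : completeNormedModType R)
    (dot : {dot H for @idfun R}) (L : {linear H -> R}) :
  hilbert_norm dot -> continuous L -> exists g, forall h, L h = dot g h.
Proof.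
move=> dotE cL.
have [L0|] := pselect (forall h, L h = 0).
  by exists 0 => h; rewrite L0 -[0 in RHS](scale0r 0) dotZl mul0r.
move=> /existsNP[h0 /eqP Lh0].
pose A := [set h | L h = 1].
have clA : closed A.
  apply: (@closed_comp _ _ L [set 1]) => [x _|]; first exact: cL.
  exact: closed_eq.
have A0 : A !=set0.
  by exists ((L h0)^-1 *: h0); rewrite /A/= linearZ/= /GRing.scale/= mulVf.
have cvA : convex_set A.
  move=> a b t; rewrite !inE => /= La Lb; rewrite /conv/=.
  rewrite /A/= linearD !linearZ/=.
  have -> : L a = 1 by exact: La.
  have -> : L b = 1 by exact: Lb.
  by rewrite /GRing.scale/= !mulr1 addrC subrK.
set p := metric_projection A 0.
have Ap : L p = 1 by exact: (projection_in dotE clA cvA A0 0).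
have pv (h : H) : L h = 0 -> dot p h = 0.
  move=> Lh.
  have H1 : 0 <= dot p h.
    have /(projection_variational dotE clA cvA A0 0) : A (p + h).
      by rewrite /A/= linearD/= Ap Lh addr0.
    by rewrite -/p [p + h]addrC addrK sub0r dotNl oppr_le0.
  have H2 : dot p h <= 0.
    have /(projection_variational dotE clA cvA A0 0) : A (p - h).
      by rewrite /A/= linearB/= Ap Lh subr0.
    by rewrite -/p [p - h]addrC addrK sub0r dotNl dotNr opprK.
  by apply/eqP; rewrite eq_le H1 H2.
have p0 : dot p p != 0.
  rewrite -dotE expf_neq0// normr_eq0; apply/eqP => p0.
  by move: Ap; rewrite p0 linear0 => /eqP; rewrite eq_sym oner_eq0.
exists ((dot p p)^-1 *: p) => h.
have : dot p (h - L h *: p) = 0.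
  by apply: pv; rewrite linearB linearZ/= Ap /GRing.scale/= mulr1 subrr.
rewrite !(dotl dot) => /subr0_eq ->.
by rewrite mulrCA mulVf// mulr1.
Qed.

(** Riesz representation makes the set in [gradient] nonempty, so [get] returns a true
    representative there. *)
Lemma gradientP (R : realType) (H : completeNormedModType R)
    (dot : {dot H for @idfun R}) (f : H -> R) (x h : H) :
  hilbert_norm dot -> differentiable f x ->
  'd f x h = dot (gradient dot f x) h.
Proof.
move=> dotE df.
have [g gP] := riesz dotE (diff_continuous df).
by have := @getPex _ [set g : H | forall h : H, 'd f x h = dot g h] (ex_intro _ g gP).
Qed.

Lemma convex_function_segment (R : realType) (H : lmodType R) (f : H -> R) (x z : H) (h : R) :
  convex_function [set: H] f -> 0 <= h <= 1 ->
  f (h *: (z - x) + x) <= h * (f z - f x) + f x.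
Proof.
move=> cf /andP[h0 h1].
have tP : Itv.spec (@Itv.num_sem R) (Itv.Real `[0%Z, 1%Z]%R) h.
  by rewrite /= /Itv.num_sem num_real/= in_itv/= h0 h1.
have := cf (Itv.mk tP) z x; rewrite !inE => /(_ I I).
rewrite /conv/= /unstable.onem.
have -> : h *: z + (1 - h) *: x = h *: (z - x) + x.
  by rewrite scalerBl scale1r scalerBr addrCA addrC.
move=> /le_trans; apply; rewrite /conv/= /unstable.onem /GRing.scale/=; lra.
Qed.

(** By convexity, the difference quotients in direction z - x with step h in ]0, 1] are at most f z
    - f x; let h tend to 0 from the right. *)
Lemma convex_diff_le (R : realType) (H : completeNormedModType R) (f : H -> R)
    (x z : H) :
  convex_function [set: H] f -> differentiable f x -> 'd f x (z - x) <= f z - f x.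
Proof.
move=> cf df; rewrite -deriveE//.
have /cvg_ex[l dl] : derivable f x (z - x) by exact: diff_derivable.
have -> : 'D_(z - x) f x = l by exact: cvg_lim dl.
have : h^-1 *: ((f \o shift x) (h *: (z - x)) - f x) @[h --> 0^'+] --> l.
  apply: cvg_trans dl; apply: cvg_app.
  by apply: within_subset => h /= h0; rewrite gt_eqF.
move=> dl'; apply: (closed_cvg (fun y => y <= f z - f x) _ _ _ dl'); first exact: closed_le.
near=> h.
have h0 : 0 < h by near: h; exact: nbhs_right_gt.
have h1 : h <= 1 by near: h; exact: nbhs_right_le.
have fh : f (h *: (z - x) + x) - f x <= h * (f z - f x).
  by rewrite lerBlDr convex_function_segment// ltW.
by rewrite /GRing.scale/= ler_pdivrMl.
Unshelve. all: by end_near. Qed.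

(** * Chain rules and monotonicity on the real line *)

Section Calculus.
Context {R : realType}.

Lemma is_derive1_diff_comp (V : normedModType R) (x : R -> V) (g : V -> R)
    (t : R) (dx : V) :
  is_derive t 1 x dx -> differentiable g (x t) ->
  is_derive t 1 (g \o x) ('d g (x t) dx).
Proof.
move=> dxt dg.
have xt : differentiable x t by apply/derivable1_diffP; exact: ex_derive.
apply: DeriveDef; first by apply/derivable1_diffP; exact: differentiable_comp.
rewrite deriveE; last exact: differentiable_comp.
by rewrite diff_comp//= -(deriveE _ xt) derive_val.
Qed.

Lemma is_derive1_comp_real (g h : R -> R) (t dg dh : R) :
  is_derive t 1 g dg -> is_derive (g t) 1 h dh ->
  is_derive t 1 (h \o g) (dh * dg).
Proof.
move=> gt hg.
have hd : differentiable h (g t) by apply/derivable1_diffP; exact: ex_derive.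
apply: (is_derive_eq (is_derive1_diff_comp gt hd)).
rewrite -[X in 'd h _ X](mulr1 dg) -[dg * 1]/(dg *: 1) linearZ/=.
by rewrite -deriveE// derive_val mulrC.
Qed.

(** Stated on an open half-line because the trajectory has only a one-sided derivative at time 0. *)
Lemma is_derive_nonincreasing (phi dphi : R -> R) (a s t : R) :
  (forall r : R, a < r -> is_derive r 1 phi (dphi r)) ->
  (forall r : R, a < r -> dphi r <= 0) ->
  a < s -> s <= t -> phi t <= phi s.
Proof.
move=> dP dle as_ st.
have der r : a < r -> derivable phi r 1 by move=> /dP ?; exact: ex_derive.
apply: (@ler0_derive1_nincry _ phi s) => // [r|r|].
- by rewrite in_itv/= andbT => sr; apply: der; exact: lt_trans sr.
- rewrite in_itv/= andbT => sr; rewrite derive1E.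
  have ar : a < r by exact: lt_trans sr.
  by have := dP _ ar => ?; rewrite derive_val dle.
- apply: derivable_within_continuous => r; rewrite in_itv/= andbT => sr.
  by apply: der; exact: lt_le_trans sr.
Qed.

End Calculus.

(** * Curves of class C^1 on the half-line and their increments *)

Section HalfLine.
Context {R : realType} {H : completeNormedModType R} (x dx : R -> H).
Hypothesis xC1 : C1_half_line x dx.

Lemma C1_half_line_is_derive (t : R) : 0 < t -> is_derive t 1 x (dx t).
Proof.
move=> t0; have /= xt := xC1.1 t (ltW t0).
have xh : h^-1 *: ((x \o shift t) (h *: 1) - x t) @[h --> 0^'] --> dx t.
  have -> : (fun h => h^-1 *: ((x \o shift t) (h *: 1) - x t)) =
      (fun s => (s - t)^-1 *: (x s - x t)) \o shift t.
    apply/funext => h /=; rewrite addrK; congr (_ *: (x (_ + _) - _)).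
    by rewrite /GRing.scale/= mulr1.
  apply: cvg_comp xt => A /=.
  rewrite /within/= !near_simpl => -[e /= e0 eA].
  (* The bound by [t] keeps t + h in the half-line, so the one-sided limit becomes two-sided. *)
  exists (Num.min e t) => /=; first by rewrite lt_min e0.
  move=> h /=; rewrite sub0r normrN lt_min => /andP[he ht] h0.
  apply: eA => /=.
  - by rewrite opprD addrCA subrr addr0 normrN.
  - by rewrite -subr_eq0 addrK.
  - by rewrite in_itv/= andbT; move: ht; rewrite ltr_norml; lra.
apply: DeriveDef; first by apply/cvg_ex; exists (dx t).
exact: cvg_lim xh.
Qed.

(** Write x s - x 0 as s times the difference quotient, which converges to [dx 0]. *)
Lemma C1_half_line_cvg0 : x t @[t --> 0^'+] --> x 0.
Proof.
have /= x0 := xC1.1 0 (lexx 0).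
have : s *: (s^-1 *: (x s - x 0)) @[s --> 0^'+] --> 0 *: dx 0.
  apply: cvgZ; first by apply: cvg_at_right_filter; exact: cvg_id.
  under eq_cvg do rewrite -[X in X^-1]subr0.
  apply: cvg_trans x0; apply: cvg_app => A.
  rewrite /at_right /within/= !near_simpl => -[e /= e0 eA].
  exists e => //= s /= se s0; apply: eA => //=; first by rewrite gt_eqF.
  by rewrite in_itv/= ltW.
rewrite scale0r => xs.
rewrite -[X in _ --> X]add0r; under eq_cvg do rewrite -[x _](subrK (x 0)).
apply: cvgD; last exact: cvg_cst.
apply: cvg_trans xs; apply: near_eq_cvg; near=> s.
by rewrite scalerA mulfV ?scale1r// gt_eqF//; near: s; exact: nbhs_right_gt.
Unshelve. all: by end_near. Qed.

End HalfLine.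

Lemma is_derive_dot (R : realType) (H : completeNormedModType R)
    (dot : {dot H for @idfun R}) (x : R -> H) (n v : H) (t : R) :
  hilbert_norm dot -> is_derive t 1 x v ->
  is_derive t 1 (fun s => dot n (x s)) (dot n v).
Proof.
move=> dotE xt.
have xl : h^-1 *: ((x \o shift t) (h *: 1) - x t) @[h --> 0^'] --> v.
  have /cvg_ex[l dl] : derivable x t 1 by exact: ex_derive.
  by rewrite -[v](derive_val) (_ : 'D_1 x t = l)//; exact: cvg_lim dl.
have nxl : h^-1 *: (((fun s => dot n (x s)) \o shift t) (h *: 1) - dot n (x t))
    @[h --> 0^'] --> dot n v.
  under eq_cvg do rewrite /= -dotNr -dotDr -[_ *: dot _ _]/(_ * dot _ _) -dotZr.
  exact: (cvg_dotr dotE).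
apply: DeriveDef; first by apply/cvg_ex; exists (dot n v).
exact: cvg_lim nxl.
Qed.

(** A mean value inequality without vector integrals. For the fixed vector n = x t - x s,
    Cauchy-Schwarz makes <n, x r> + |n| G r nonincreasing in r. Comparing times s and t gives |n|^2
    <= |n| (G s - G t). *)
Lemma norm_increment_le (R : realType) (H : completeNormedModType R)
    (dot : {dot H for @idfun R}) (x dx : R -> H) (G dG : R -> R) (a s t : R) :
  hilbert_norm dot ->
  (forall r : R, a < r -> is_derive r 1 x (dx r)) ->
  (forall r : R, a < r -> is_derive r 1 G (- dG r)) ->
  (forall r : R, a < r -> `|dx r| <= dG r) ->
  a < s -> s <= t -> `|x t - x s| <= G s - G t.
Proof.
move=> dotE xP GP dxle as_ st.
set n := x t - x s.
have : dot n (x t) + `|n| * G t <= dot n (x s) + `|n| * G s.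
  pose phi r := dot n (x r) + `|n| * G r.
  pose dphi r := dot n (dx r) + `|n| * (- dG r).
  apply: (@is_derive_nonincreasing _ phi dphi a) => // r ar.
    apply: is_deriveD; first by apply: is_derive_dot => //; exact: xP.
    by have := GP _ ar => ?; exact: is_deriveZ.
  rewrite /dphi mulrN subr_le0 (le_trans (dot_le_norm dotE _ _))//.
  by rewrite ler_wpM2l// dxle.
have nn : dot n (x t) - dot n (x s) = `|n| * `|n|.
  by rewrite -dotNr -dotDr -dotE expr2.
have [->|n0] := eqVneq n 0.
  move=> _; rewrite normr0 subr_ge0.
  apply: (@is_derive_nonincreasing _ G (fun r => - dG r) a) => // r ar.
  by rewrite oppr_le0 (le_trans _ (dxle _ ar)).
have n1 : 0 < `|n| by rewrite normr_gt0.
move=> h; rewrite -(ler_pM2l n1) -nn mulrBr.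
by rewrite lerBlDr addrAC lerBrDr [leRHS]addrC.
Qed.

(** * Distance to a set and the minimum value *)

Lemma mul_dist_ge (R : realType) (H : completeNormedModType R) (S : set H)
    (x : H) (A a : R) :
  S !=set0 -> 0 <= a -> (forall z, S z -> A <= a * `|x - z|) -> A <= a * dist x S.
Proof.
move=> S0; rewrite le_eqVlt => /predU1P[<-|a0] AP.
  by case: S0 => z /AP; rewrite !mul0r.
rewrite mulrC -ler_pdivrMr//; apply: lb_le_inf.
  by case: S0 => z Sz; exists `|x - z|, z.
by move=> _ [z Sz <-]; rewrite ler_pdivrMr// mulrC AP.
Qed.

Lemma attains_min_val (R : realType) (H : completeNormedModType R) (Q : set H)
    (f : H -> R) :
  attains_min Q f ->
  argmin Q f !=set0 /\ (forall y, Q y -> min_val Q f <= f y).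
Proof.
move=> [m Qm mle].
have mv : min_val Q f = f m.
  apply/eqP; rewrite eq_le; apply/andP; split.
    by apply: ge_inf; [exists (f m) => _ [y Qy <-]; exact: mle|exists m].
  by apply: lb_le_inf; [exists (f m), m|move=> _ [y Qy <-]; exact: mle].
by split; [exists m; split|rewrite mv].
Qed.

(** * The step size [lambda] and its primitive [Gamma] *)

Section Lambda.
Context {R : realType} (K alpha : R).
Hypotheses (K0 : 0 < K) (alpha0 : 0 < alpha).

Lemma lambda_gt0 t : 0 <= t -> 0 < lambda K alpha t.
Proof. by move=> t0; rewrite divr_gt0// powR_gt0// ltr_pwDl. Qed.

Lemma lambda_le t : 0 <= t -> lambda K alpha t <= K.
Proof.
move=> t0; rewrite /lambda ler_pdivrMr; last by rewrite powR_gt0// ltr_pwDl.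
rewrite ler_peMr ?(ltW K0)// -[leLHS](powRr0 (1 + t)).
by apply: ler_powR; rewrite ?lerDl// ltW.
Qed.

Lemma continuous_lambda t : 0 <= t -> {for t, continuous (lambda K alpha)}.
Proof.
move=> t0; have t1 : 0 < 1 + t by rewrite ltr_pwDl.
rewrite /lambda; apply: cvgM; first exact: cvg_cst.
apply: cvgV; first by rewrite gt_eqF// powR_gt0.
apply: (@continuous_cvg _ _ _ (nbhs t) _ (fun s => 1 + s) (@powR R ^~ alpha)).
  apply/differentiable_continuous/derivable1_diffP.
  by have := is_derive1_powR alpha t1 => ?; exact: ex_derive.
by apply: cvgD; [exact: cvg_cst|exact: cvg_id].
Qed.

Lemma is_derive_Gamma (t : R) : 0 < t ->
  is_derive t 1 (Gamma K alpha) (lambda K alpha t).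
Proof.
move=> t0.
(* The endpoint t + 1 is chosen to make t interior to the interval of integration. *)
have [] := @continuous_FTC1_closed _ (lambda K alpha) 0 t (t + 1).
- by rewrite ltrDl.
- apply: continuous_compact_integrable; first exact: segment_compact.
  apply: continuous_in_subspaceT => s; rewrite inE/= in_itv/= => /andP[s0 _].
  exact: continuous_lambda.
- exact: t0.
- by apply: continuous_lambda; exact: ltW.
by move=> d1 d2; apply: DeriveDef => //; rewrite -derive1E.
Qed.

Lemma Gamma_ge0 t : 0 <= Gamma K alpha t.
Proof.
apply: Rintegral_ge0 => s /=; rewrite in_itv/= => /andP[s0 _].
exact/ltW/lambda_gt0.
Qed.

End Lambda.

(** * Invariance of [Q] and the two basic inequalities along the trajectory *)

Section Trajectory.
Context {R : realType} {H : completeNormedModType R} (dot : {dot H for @idfun R}).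
Context (Q : set H) (f : H -> R) (K alpha : R) (x dx : R -> H).
Hypotheses (dotE : hilbert_norm dot) (clQ : closed Q) (cvQ : convex_set Q).
Hypotheses (df : forall z : H, differentiable f z) (cf : convex_function [set: H] f).
Hypotheses (minf : attains_min Q f) (K0 : 0 < K).
Hypotheses (Qx0 : Q (x 0)) (xC1 : C1_half_line x dx).
Hypothesis ode : forall t : R, 0 <= t ->
  dx t + x t = metric_projection Q (x t - lambda K alpha t *: gradient dot f (x t)).

Let Q0 : Q !=set0. Proof. by exists (x 0). Qed.

(* For [q] the projection of [x t] onto [Q] and [n = x t - q], the function
   [s |-> e^s <n, x s - q>] is nonincreasing, since [dx s + x s] lies in [Q]. *)
Lemma trajectory_in (t : R) : 0 <= t -> Q (x t).
Proof.
rewrite le_eqVlt => /predU1P[<-//|t0].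
set q := metric_projection Q (x t); set n := x t - q.
have nle z : Q z -> dot n (z - q) <= 0 by exact: projection_variational.
pose phi (s : R) := expR s * dot n (x s - q).
pose dphi (s : R) := expR s * dot n (dx s + x s - q).
have phiP (s : R) : 0 < s -> is_derive s 1 phi (dphi s).
  move=> s0; have := C1_half_line_is_derive xC1 s0 => xs.
  have d1 : is_derive s 1 (fun r => dot n (x r - q)) (dot n (dx s)).
    rewrite -[dx s]subr0; apply: is_derive_dot => //.
  apply: (is_derive_eq (is_deriveM (is_derive_expR s) d1)).
  by rewrite /dphi -addrA [in RHS]dotDr mulrDr; congr (_ + _); rewrite mulrC.
have phi_le (s : R) : 0 < s -> s <= t -> phi t <= phi s.
  move=> s0 st; apply: (@is_derive_nonincreasing _ phi dphi 0) => // r r0.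
  rewrite /dphi pmulr_rle0 ?expR_gt0// ode ?(ltW r0)//; apply: nle.
  exact: projection_in.
have phi0 : phi s @[s --> 0^'+] --> phi 0.
  apply: cvgM; first by apply: cvg_at_right_filter; exact: continuous_expR.
  apply: (cvg_dotr dotE); apply: cvgB; first exact: C1_half_line_cvg0 xC1.
  exact: cvg_cst.
(* Monotonicity extends to time 0 by the right limit, and phi 0 <= 0 because x 0 lies in [Q]. As x t
   - q is n itself, phi t = e^t |n|^2, which forces x t = q. *)
have : phi t <= 0.
  apply: (@le_trans _ _ (phi 0)); last by rewrite /phi expR0 mul1r nle.
  apply: (closed_cvg (fun y => phi t <= y) _ _ _ phi0); first exact: closed_ge.
  near=> s; apply: phi_le; first by near: s; exact: nbhs_right_gt.
  by near: s; exact: nbhs_right_le.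
rewrite /phi pmulr_rle0 ?expR_gt0// -dotE.
rewrite le_eqVlt ltNge sqr_ge0 orbF sqrf_eq0 normr_eq0 subr_eq0 => /eqP ->.
exact: projection_in.
Unshelve. all: by end_near. Qed.

Let slope t := - dot (gradient dot f (x t)) (dx t).

Lemma is_derive_value (t : R) : 0 < t ->
  is_derive t 1 (fun s => f (x s) - min_val Q f) (- slope t).
Proof.
move=> t0; have := C1_half_line_is_derive xC1 t0 => xt.
rewrite /slope [X in is_derive _ _ _ X]opprK -(gradientP _ dotE)// -[X in is_derive _ _ _ X]subr0.
exact: (is_deriveB (is_derive1_diff_comp xt (df (x t)))
  (is_derive_cst (min_val Q f) t 1)).
Qed.

Lemma trajectory_variational t z : 0 <= t -> Q z ->
  0 <= dot (dx t + lambda K alpha t *: gradient dot f (x t)) (z - x t - dx t).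
Proof.
move=> t0 Qz; have := projection_variational dotE clQ cvQ Q0
  (x t - lambda K alpha t *: gradient dot f (x t)) Qz.
rewrite -ode// !(dotl dot) => h; lra.
Qed.

Lemma sqr_speed_le t : 0 <= t -> `|dx t| ^+ 2 <= lambda K alpha t * slope t.
Proof.
move=> t0; have := trajectory_variational t0 (trajectory_in t0).
rewrite subrr sub0r /slope dotE !(dotl dot) => h; lra.
Qed.

(** Test the variational inequality at a minimizer z. Convexity bounds <g, z - x> by -F,
    Cauchy-Schwarz bounds <x', z - x>, and the term -|x'|^2 is dropped. The infimum over z then
    yields the distance. *)
Lemma value_le t : 0 <= t ->
  lambda K alpha t * (f (x t) - min_val Q f) <=
  `|dx t| * dist (x t) (argmin Q f) + lambda K alpha t * slope t.
Proof.
move=> t0; rewrite -lerBlDr; apply: mul_dist_ge => //.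
  exact: (attains_min_val minf).1.
move=> z [Qz fz]; have := trajectory_variational t0 Qz.
have l0 := lambda_gt0 alpha K0 t0.
have := convex_diff_le z cf (df (x t)); rewrite (gradientP _ dotE)// fz.
rewrite -(ler_pM2l l0).
have := dot_le_norm dotE (dx t) (z - x t); rewrite distrC.
have := sqr_ge0 `|dx t|; rewrite dotE.
rewrite /slope !(dotl dot).
move: (lambda K alpha t) (`|_| * _) => l a h1 h2 h3 h4; lra.
Qed.

End Trajectory.

(** * Pointwise consequences of the error bound *)

(* In the two lemmas below, [F], [v], [d], [l] and [y] stand for the values at one
   time of [f x - min f], [|x'|], [dist x argmin], [lambda] and [- dF/dt]; [F1] is
   an a priori bound on [F]. *)
Section Descent.
Context {R : realType}.

Lemma gt0_powRD (a r s : R) : 0 < a -> a `^ (r + s) = a `^ r * a `^ s.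
Proof. by move=> a0; rewrite powRD// [a == 0]gt_eqF// implybT. Qed.

(** If y >= F/2, write F = F^(2 theta - 1) F^(2 - 2 theta): the first exponent is nonpositive and F
    <= F1, so with l <= K the second term of the minimum works. If y < F/2, then l y absorbs less
    than half of l F, so l F / 2 <= v d. The error bound turns this into v >= kappa l F^(1 - theta)
    / 2, and v^2 <= l y gives the first term. *)
Lemma loja_slope_ge (F F1 y v d l K kappa theta : R) :
  0 < F <= F1 -> 0 < l <= K -> 0 < kappa -> 0 < theta <= 2^-1 -> 0 <= v ->
  v ^+ 2 <= l * y -> l * F <= v * d + l * y -> kappa * d <= F `^ theta ->
  Num.min (kappa ^+ 2 / 4) (F1 `^ (2 * theta - 1) / (2 * K)) *
    (l * F `^ (2 - 2 * theta)) <= y.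
Proof.
move=> /andP[F0 FF1] /andP[l0 lK] kappa0 /andP[theta0 theta12] v0 vy lF kd.
have K0 : 0 < K by exact: lt_le_trans lK.
have FE : F = F `^ theta * F `^ (1 - theta).
  by rewrite -gt0_powRD// addrCA subrr addr0 powRr1 ?ltW.
have F2E : F `^ (2 - 2 * theta) = F `^ (1 - theta) ^+ 2.
  rewrite expr2 -gt0_powRD//; congr (_ `^ _); lra.
have [Fy|yF] := leP (F / 2) y.
  apply: le_trans Fy.
  apply: (@le_trans _ _ (F1 `^ (2 * theta - 1) / (2 * K) * (K * F `^ (2 - 2 * theta)))).
    apply: ler_pM; rewrite ?ge_min ?lexx ?orbT//.
    - by rewrite le_min !divr_ge0 ?sqr_ge0 ?powR_ge0// mulr_ge0 ?ltW.
    - by rewrite mulr_ge0 ?powR_ge0 ?ltW.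
    - by rewrite ler_wpM2r ?powR_ge0.
  rewrite (_ : _ * _ = F1 `^ (2 * theta - 1) * F `^ (2 - 2 * theta) / 2); last first.
    by field; rewrite gt_eqF.
  rewrite ler_pM2r//.
  apply: (@le_trans _ _ (F `^ (2 * theta - 1) * F `^ (2 - 2 * theta))).
    rewrite ler_wpM2r ?powR_ge0// -[2 * theta - 1]opprB !powRN.
    rewrite lef_pV2 ?posrE ?powR_gt0//; last exact: lt_le_trans FF1.
    apply: ge0_ler_powR; rewrite ?nnegrE ?(ltW F0) ?(ltW (lt_le_trans F0 FF1))//; lra.
  rewrite -gt0_powRD// (_ : 2 * theta - 1 + (2 - 2 * theta) = 1); last by ring.
  by rewrite powRr1// ltW.
rewrite F2E in lF *; set p := F `^ theta in FE kd *; set q := F `^ (1 - theta) in FE *.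
have p0 : 0 < p by exact: powR_gt0.
have q0 : 0 < q by exact: powR_gt0.
apply: (@le_trans _ _ (kappa ^+ 2 / 4 * (l * q ^+ 2))).
  by rewrite ler_wpM2r ?ge_min ?lexx// mulr_ge0 ?sqr_ge0 ?ltW.
have h1 : l * F / 2 <= v * d by nra.
have h2 : kappa * l * q / 2 <= v.
  rewrite -(ler_pM2r p0); apply: le_trans (ler_wpM2l v0 kd).
  rewrite -(ler_pM2l kappa0) FE in h1.
  rewrite [leLHS](_ : _ = kappa * (l * (p * q) / 2)); last by field.
  by rewrite (mulrCA v).
have h3 : (kappa * l * q / 2) ^+ 2 <= v ^+ 2.
  by rewrite ler_pXn2r ?nnegrE// !mulr_ge0 ?invr_ge0 ?ltW.
rewrite -(ler_pM2l l0); apply: le_trans vy; apply: le_trans h3.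
by rewrite le_eqVlt; apply/orP; left; apply/eqP; field.
Qed.

(** With q = F^(1 - theta), multiplying v^2 <= l y by c q^2 and using c l q^2 <= y gives (sqrt c q
    v)^2 <= y^2. The right-hand side is written as a multiple of -d/dt F^theta, ready to be
    integrated. *)
Lemma loja_speed_le (F y v l c theta : R) :
  0 < F -> 0 < l -> 0 < c -> 0 < theta -> 0 <= v -> v ^+ 2 <= l * y ->
  c * (l * F `^ (2 - 2 * theta)) <= y ->
  v <= (theta * Num.sqrt c)^-1 * (theta * F `^ (theta - 1) * y).
Proof.
move=> F0 l0 c0 theta0 v0 vy cy.
have F2E : F `^ (2 - 2 * theta) = F `^ (1 - theta) ^+ 2.
  rewrite expr2 -gt0_powRD//; congr (_ `^ _); lra.
rewrite F2E in cy; rewrite -[theta - 1]opprB powRN.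
set q := F `^ (1 - theta) in cy *.
have q0 : 0 < q by exact: powR_gt0.
have s0 : 0 < Num.sqrt c by rewrite sqrtr_gt0.
have y0 : 0 <= y by apply: le_trans cy; rewrite !mulr_ge0 ?sqr_ge0 ?ltW.
rewrite [leRHS](_ : _ = y / (Num.sqrt c * q)); last first.
  by field; rewrite !gt_eqF.
rewrite ler_pdivlMr ?mulr_gt0// -(@ler_pXn2r _ 2)// ?nnegrE//; last first.
  by apply: mulr_ge0 => //; apply: mulr_ge0; exact: ltW.
rewrite !exprMn sqr_sqrtr ?(ltW c0)//.
apply: (@le_trans _ _ (l * y * (c * q ^+ 2))).
  by rewrite ler_wpM2r// mulr_ge0 ?sqr_ge0 ?ltW.
rewrite [leLHS](_ : _ = y * (c * (l * q ^+ 2))); last by ring.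
by rewrite expr2 ler_wpM2l.
Qed.

End Descent.

(** * Integration of the differential inequalities for F *)

Section Decay.
Context {R : realType} (K alpha a : R) (F y : R -> R).
Hypotheses (K0 : 0 < K) (alpha01 : 0 < alpha < 1) (a0 : 0 <= a).
Hypothesis Fgt0 : forall t : R, a < t -> 0 < F t.
Hypothesis FP : forall t : R, a < t -> is_derive t 1 F (- y t).

Lemma is_derive_powR_comp (p t : R) : a < t ->
  is_derive t 1 (fun s => F s `^ p) (- (p * F t `^ (p - 1) * y t)).
Proof.
move=> t0; rewrite -mulrN.
apply: (is_derive1_comp_real (h := @powR R ^~ p)); first exact: FP.
exact/is_derive1_powR/Fgt0.
Qed.

(** The derivative of F^(-b) is b F^(-b-1) y >= b c lambda, so F^(-b) grows at least like a multiple
    of (1 + t)^(1 - alpha). *)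
Lemma power_decay (b c : R) : 0 < b -> 0 < c ->
  (forall t : R, a < t -> c * (lambda K alpha t * F t `^ (1 + b)) <= y t) ->
  exists2 M : R, 0 < M & forall t : R, a + 1 <= t -> F t <= M * t `^ (- ((1 - alpha) / b)).
Proof.
move=> b0 c0 yP; have /andP[alpha0 alpha1] := alpha01.
have aa1 : a < a + 1 by rewrite ltrDl.
have a1 : 0 < 1 - alpha by rewrite subr_gt0.
have a2 : 0 < 1 + (a + 1) by rewrite addr_gt0// ltr_wpDl.
(* The first term of the minimum makes [phi] nonincreasing; the second makes it nonpositive at a +
   1. *)
pose m := Num.min (b * c * K / (1 - alpha)) (F (a + 1) `^ (- b) / (1 + (a + 1)) `^ (1 - alpha)).
have m0 : 0 < m.
  by rewrite lt_min !divr_gt0 ?mulr_gt0 ?powR_gt0 ?Fgt0.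
pose phi t := m * (1 + t) `^ (1 - alpha) - F t `^ (- b).
pose dphi t := m * ((1 - alpha) * (1 + t) `^ (- alpha)) - b * F t `^ (- b - 1) * y t.
have phiP (t : R) : a < t -> is_derive t 1 phi (dphi t).
  move=> at_; have t0 : 0 < t by exact: le_lt_trans at_.
  have t1 : 0 < 1 + t by rewrite addr_gt0.
  have d1 : is_derive t 1 (fun s => (1 + s) `^ (1 - alpha))
      ((1 - alpha) * (1 + t) `^ (- alpha)).
    rewrite -[X in is_derive _ _ _ X]mulr1.
    apply: (is_derive1_comp_real (g := fun s => 1 + s) (h := @powR R ^~ (1 - alpha))).
      by rewrite -[X in is_derive _ _ _ X]add0r; apply: is_deriveD.
    by have := is_derive1_powR (1 - alpha) t1; rewrite addrAC subrr add0r.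
  have := is_derive_powR_comp (- b) at_; rewrite !mulNr opprK => d2.
  apply: is_deriveB; exact: is_deriveZ.
have dphi_le (t : R) : a < t -> dphi t <= 0.
  move=> at_; have t0 : 0 < t by exact: le_lt_trans at_.
  have t1 : 0 < 1 + t by rewrite addr_gt0.
  rewrite subr_le0; have F0 := Fgt0 at_.
  apply: (@le_trans _ _ (b * c * K * (1 + t) `^ (- alpha))).
    rewrite mulrA ler_wpM2r ?powR_ge0// -ler_pdivlMr//.
    by rewrite ge_min lexx.
  have := yP _ at_; rewrite /lambda -powRN => yt.
  apply: (@le_trans _ _ (b * F t `^ (- b - 1) *
      (c * (K * (1 + t) `^ (- alpha) * F t `^ (1 + b))))); last first.
    by rewrite ler_wpM2l// mulr_ge0 ?powR_ge0 ?ltW.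
  have E : F t `^ (1 + b) * F t `^ (- b - 1) = 1.
    by rewrite -gt0_powRD// (_ : 1 + b + (- b - 1) = 0) ?powRr0//; ring.
  rewrite le_eqVlt; apply/orP; left; apply/eqP.
  transitivity (b * c * K * (1 + t) `^ (- alpha) * (F t `^ (1 + b) * F t `^ (- b - 1))).
    by rewrite E mulr1.
  ring.
have phi1 : phi (a + 1) <= 0.
  rewrite subr_le0 -ler_pdivlMr ?powR_gt0//.
  by rewrite ge_min lexx orbT.
exists (m `^ (- b^-1)); first exact: powR_gt0.
move=> t t1; have at_ : a < t by exact: lt_le_trans t1.
have t0 : 0 < t by exact: le_lt_trans at_.
have F0 := Fgt0 at_.
have : phi t <= 0.
  by apply: le_trans phi1; apply: (@is_derive_nonincreasing _ phi dphi a).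
rewrite subr_le0 => h.
have {}h : m * t `^ (1 - alpha) <= F t `^ (- b).
  apply: le_trans h; rewrite ler_pM2l//.
  apply: ge0_ler_powR; rewrite ?nnegrE ?lerDr ?(ltW t0) ?(ltW a1)//.
  by rewrite addr_ge0 ?(ltW t0).
have -> : F t = (F t `^ (- b)) `^ (- b^-1).
  by rewrite -powRrM mulrNN mulfV ?gt_eqF// powRr1// ltW.
have -> : t `^ (- ((1 - alpha) / b)) = (t `^ (1 - alpha)) `^ (- b^-1).
  by rewrite -powRrM mulrN.
rewrite -powRM ?powR_ge0 ?(ltW m0)// !(powRN _ b^-1).
rewrite lef_pV2 ?posrE ?powR_gt0 ?mulr_gt0 ?powR_gt0//.
apply: ge0_ler_powR; rewrite ?nnegrE ?powR_ge0 ?invr_ge0 ?(ltW b0)//.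
by rewrite mulr_ge0 ?powR_ge0 ?(ltW m0).
Qed.

(** Gronwall argument: F e^(c Gamma) is nonincreasing, since Gamma' = lambda. *)
Lemma exp_decay (c : R) :
  (forall t : R, a < t -> c * (lambda K alpha t * F t) <= y t) ->
  exists2 M : R, 0 < M & forall t : R, a + 1 <= t -> F t <= M * expR (- (c * Gamma K alpha t)).
Proof.
move=> yP.
pose phi t := F t * expR (c * Gamma K alpha t).
pose dphi t := (c * (lambda K alpha t * F t) - y t) * expR (c * Gamma K alpha t).
have aa1 : a < a + 1 by rewrite ltrDl.
exists (phi (a + 1)); first by rewrite mulr_gt0 ?expR_gt0 ?Fgt0.
move=> t t1.
rewrite expRN ler_pdivlMr ?expR_gt0//.
apply: (@is_derive_nonincreasing _ phi dphi a) => // r r0; last first.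
  by rewrite pmulr_lle0 ?expR_gt0// subr_le0 yP.
have d1 : is_derive r 1 (fun s => expR (c * Gamma K alpha s))
    (expR (c * Gamma K alpha r) * (c * lambda K alpha r)).
  apply: (is_derive1_comp_real (g := fun s => c * Gamma K alpha s) (h := @expR R)).
  have := is_derive_Gamma K alpha (le_lt_trans a0 r0) => dG; exact: is_deriveZ.
apply: (is_derive_eq (is_deriveM (FP r0) d1)).
rewrite /dphi /GRing.scale/=; ring.
Qed.

End Decay.

(** * Asymptotics at infinity and the convergence theorem *)

Lemma bigO_pinfty (R : realType) (g h : R -> R) (C T : R) :
  0 < C -> (forall t : R, T <= t -> `|g t| <= C * `|h t|) -> g =O_+oo h.
Proof.
move=> C0 gh; apply/eqO_exP; exists C => //.
by near=> t; apply: gh; near: t; exact: (nbhs_pinfty_ge (num_real _)).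
Unshelve. all: by end_near. Qed.

Lemma powRN_cvgy0 (R : realType) (p : R) : 0 < p -> t `^ (- p) @[t --> +oo] --> 0.
Proof.
move=> p0; apply/cvgrPdist_le => e e0; near=> t.
have t0 : 0 < t by near: t; exact: (nbhs_pinfty_gt (num_real _)).
have te : e `^ (- p^-1) <= t by near: t; exact: (nbhs_pinfty_ge (num_real _)).
rewrite sub0r normrN ger0_norm ?powR_ge0// powRN.
rewrite -[e]invrK lef_pV2 ?posrE ?invr_gt0 ?powR_gt0//.
have -> : e^-1 = (e `^ (- p^-1)) `^ p.
  by rewrite -powRrM mulNr mulVf ?gt_eqF// powR_inv1// ltW.
by apply: ge0_ler_powR => //; rewrite ?nnegrE ?powR_ge0// ltW.
Unshelve. all: by end_near. Qed.

Theorem corollary1p1 (R : realType) (H : completeNormedModType R)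
    (dot : {dot H for @idfun R}) (Q : set H) (f : H -> R)
    (K alpha kappa theta : R) :
  hilbert_norm dot ->
  closed Q -> convex_set Q -> Q !=set0 ->
  (forall x : H, differentiable f x) -> continuous (gradient dot f) ->
  convex_function [set: H] f ->
  locally_lipschitz (gradient dot f) ->
  attains_min Q f ->
  0 < K -> 0 < alpha < 1 ->
  0 < kappa -> 0 < theta <= 2^-1 ->
  (forall x : H, Q x ->
     kappa * dist x (argmin Q f) <= (f x - min_val Q f) `^ theta) ->
  forall x0 : H, Q x0 ->
  forall x : R -> H, cauchy_solution dot Q f K alpha x0 x ->
  exists xinf : H,
    [/\ argmin Q f xinf,
        x t @[t --> +oo] --> xinf,
        theta < 2^-1 ->
          (fun t : R => `|x t - xinf|) =O_+oo
            (fun t : R => t `^ (- ((1 - alpha) * theta / (1 - 2 * theta)))) /\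
          (fun t : R => f (x t) - min_val Q f) =O_+oo
            (fun t : R => t `^ (- ((1 - alpha) / (1 - 2 * theta))))
      & theta = 2^-1 ->
          exists2 delta : R, 0 < delta &
            (fun t : R => `|x t - xinf|) =O_+oo
              (fun t : R => expR (- (delta * Gamma K alpha t))) /\
            (fun t : R => f (x t) - min_val Q f) =O_+oo
              (fun t : R => expR (- (delta * Gamma K alpha t)))].
Proof.
move=> dotE clQ cvQ _ df _ cf _ minf K0 alpha01 kappa0 theta012 loja x0 Qx0 x.
move=> [xx0 [dx [xC1 ode]]].
have /andP[alpha0 alpha1] := alpha01.
have /andP[theta0 theta12] := theta012.
rewrite -xx0 in Qx0.
pose F t := f (x t) - min_val Q f.
pose y t := - dot (gradient dot f (x t)) (dx t).
have xin t : 0 <= t -> Q (x t) by exact: (trajectory_in dotE clQ cvQ Qx0 xC1 ode).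
have F_ge0 t : 0 <= t -> 0 <= F t.
  by move=> /xin Qt; rewrite subr_ge0; exact: (attains_min_val minf).2.
have vy t : 0 <= t -> `|dx t| ^+ 2 <= lambda K alpha t * y t.
  exact: (sqr_speed_le dotE clQ cvQ Qx0 xC1 ode).
have FP (t : R) : 0 < t -> is_derive t 1 F (- y t).
  exact: (is_derive_value Q dotE df xC1).
have y_ge0 t : 0 <= t -> 0 <= y t.
  move=> t0; have l0 := lambda_gt0 alpha K0 t0.
  by rewrite -(pmulr_rge0 _ l0) (le_trans _ (vy _ t0))// sqr_ge0.
have Fle (s t : R) : 0 < s -> s <= t -> F t <= F s.
  apply: (@is_derive_nonincreasing _ F (fun t => - y t) 0) => // r r0.
  by rewrite oppr_le0 y_ge0// ltW.
(* Negative powers of F need F > 0, so the case where F reaches 0 is treated apart. *)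
have [[T T0 FT0]|FN0] := pselect (exists2 T, 0 < T & F T = 0).
  have F0 t : T <= t -> F t = 0.
    move=> Tt; apply/eqP; rewrite eq_le -{1}FT0 Fle// F_ge0// ltW//.
    exact: lt_le_trans Tt.
  have dx0 t : T < t -> dx t = 0.
    move=> Tt; have t0 : 0 < t by exact: lt_trans Tt.
    (* F has an interior minimum at t on ]0, t + 1[, so F' vanishes there. *)
    have y0 : y t = 0.
      have d0 : is_derive t 1 F 0.
        apply: (@derive1_at_min _ F 0 (t + 1)).
        - by rewrite addr_ge0// ltW.
        - move=> s; rewrite in_itv/= => /andP[s0 _].
          by have := FP _ s0 => ?; exact: ex_derive.
        - by rewrite in_itv/= t0 ltrDl ltr01.
        - move=> s; rewrite in_itv/= => /andP[s0 _].
          by rewrite (F0 _ (ltW Tt)) F_ge0// ltW.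
      have := FP _ t0 => d1.
      have := @derive_val _ _ _ _ _ _ _ d1; rewrite (@derive_val _ _ _ _ _ _ _ d0).
      by move=> /esym/eqP; rewrite oppr_eq0 => /eqP.
    have := vy _ (ltW t0); rewrite y0 mulr0 => v0.
    apply/eqP; rewrite -normr_eq0 -sqrf_eq0 eq_le v0 sqr_ge0//.
  have xc t : T + 1 <= t -> x t = x (T + 1).
    move=> Tt; apply/eqP; rewrite -subr_eq0 -normr_le0.
    have T1 : T < T + 1 by rewrite ltrDl.
    rewrite -(subrr (0 : R)).
    apply: (@norm_increment_le _ _ dot x dx (cst 0) (cst 0) T) => // r Tr.
    - by apply: C1_half_line_is_derive => //; exact: lt_trans Tr.
    - by rewrite oppr0; exact: is_derive_cst.
    - by rewrite dx0// normr0.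
  have T1 : 0 <= T + 1 by rewrite addr_ge0// ltW.
  (* Both quantities are eventually 0, so any comparison function will do, and [delta] = 1 below is
     arbitrary. *)
  have bigO0 (h : R -> R) :
      (fun t => `|x t - x (T + 1)|) =O_+oo h /\ F =O_+oo h.
    split; apply: (@bigO_pinfty _ _ _ 1 (T + 1)) => // t Tt.
      by rewrite xc// subrr !normr0 mulr_ge0.
    by rewrite F0 ?normr0 ?mulr_ge0// (le_trans _ Tt)// lerDl.
  exists (x (T + 1)); split.
  - split; first exact: xin.
    by apply/eqP; rewrite -subr_eq0; apply/eqP/F0; rewrite lerDl.
  - apply: cvg_near_cst; near=> t; apply: xc.
    by near: t; exact: (nbhs_pinfty_ge (num_real _)).
  - by move=> _; split; apply bigO0.
  - by move=> _; exists 1 => //; split; apply bigO0.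
have Fgt0 t : 0 < t -> 0 < F t.
  move=> t0; rewrite lt_neqAle F_ge0 ?(ltW t0)// andbT eq_sym.
  by apply/eqP => Ft0; apply: FN0; exists t.
have F10 : 0 < F 1 by exact: Fgt0.
(* The constant of [loja_slope_ge] with [F 1] as the a priori bound: F is nonincreasing, hence at
   most [F 1] after time 1. *)
pose c := Num.min (kappa ^+ 2 / 4) (F 1 `^ (2 * theta - 1) / (2 * K)).
have c0 : 0 < c.
  by rewrite lt_min !divr_gt0 ?exprn_gt0 ?powR_gt0// mulr_gt0.
have gt0 (t : R) : 1 < t -> 0 < t by exact: lt_trans.
have cy t : 1 < t -> c * (lambda K alpha t * F t `^ (2 - 2 * theta)) <= y t.
  move=> t1; have t0 := gt0 _ t1.
  apply: (@loja_slope_ge _ (F t) (F 1) (y t) `|dx t|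
    (dist (x t) (argmin Q f)) (lambda K alpha t) K kappa theta) => //.
  - by rewrite Fgt0// Fle// ltW.
  - by rewrite lambda_gt0 ?lambda_le ?ltW.
  - exact/vy/ltW.
  - exact: (value_le dotE clQ cvQ df cf minf K0 Qx0 ode (ltW t0)).
  - by apply: loja; apply: xin; exact: ltW.
pose C := (theta * Num.sqrt c)^-1.
have C0 : 0 < C by rewrite invr_gt0 mulr_gt0// sqrtr_gt0.
(* The speed is at most -d/dt (C F^theta), so the increment telescopes; the later value of C F^theta
   is dropped. *)
have xF s t : 1 < s -> s <= t -> `|x t - x s| <= C * F s `^ theta.
  move=> s1 st.
  pose dG t := C * (theta * F t `^ (theta - 1) * y t).
  apply: (@le_trans _ _ (C * F s `^ theta - C * F t `^ theta)); last first.
    by rewrite gerBl mulr_ge0 ?powR_ge0 ?ltW.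
  apply: (@norm_increment_le _ _ dot x dx (fun t => C * F t `^ theta) dG 1) => // r r1.
  - exact/C1_half_line_is_derive/gt0.
  - have := @is_derive_powR_comp _ 0 _ _ Fgt0 FP theta r (gt0 _ r1) => d1.
    by rewrite /dG -mulrN; exact: is_deriveZ.
  - have r0 := gt0 _ r1.
    apply: (loja_speed_le (l := lambda K alpha r)) => //.
    + exact: Fgt0.
    + by apply: lambda_gt0 => //; exact: ltW.
    + exact/vy/ltW.
    + exact: cy.
(* A crude rate, valid for all [theta]: as [F] is bounded, the differential
   inequality also holds with exponent 2. *)
have [M M0 FM] : exists2 M : R, 0 < M & forall t : R, 2 <= t -> F t <= M * t `^ (- (1 - alpha)).
  have [] := @power_decay _ K alpha 1 F y K0 alpha01 ler01 (fun t t1 => Fgt0 t (gt0 t t1))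
    (fun t t1 => FP t (gt0 t t1)) 1 (c / F 1 `^ (2 * theta)).
  - exact: ltr01.
  - by rewrite divr_gt0// powR_gt0.
  - move=> t t1; apply: le_trans (cy _ t1).
    have t0 := gt0 _ t1; have Ft0 := Fgt0 _ t0.
    rewrite -mulrA ler_pM2l// ler_pdivrMl ?powR_gt0// mulrCA ler_pM2l; last first.
      by apply: lambda_gt0 => //; exact: ltW.
    rewrite (_ : 1 + 1 = 2 * theta + (2 - 2 * theta)); last by ring.
    rewrite gt0_powRD// ler_pM2r ?powR_gt0//.
    by apply: ge0_ler_powR; rewrite ?nnegrE ?mulr_ge0 ?(ltW theta0) ?(ltW Ft0) ?(ltW F10)// Fle// ltW.
  - by move=> M M0 FM; exists M => // t t2; rewrite -[1 - alpha]divr1; exact: FM.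
have aa : 0 < 1 - alpha by rewrite subr_gt0.
(* The crude rate sends F and F^theta to 0, which gives the Cauchy property and the minimality of
   the limit. *)
have F_cvg0 : F t @[t --> +oo] --> 0.
  apply: (@squeeze_cvgr _ _ _ _ (cst 0) (fun t => M * t `^ (- (1 - alpha)))).
  - near=> t; apply/andP; split.
      by apply: F_ge0; near: t; exact: (nbhs_pinfty_ge (num_real _)).
    by apply: FM; near: t; exact: (nbhs_pinfty_ge (num_real _)).
  - exact: cvg_cst.
  - rewrite -[X in _ --> X](mulr0 M); apply: cvgM; first exact: cvg_cst.
    exact: powRN_cvgy0.
have Fth_cvg0 : F t `^ theta @[t --> +oo] --> 0.
  apply: (@squeeze_cvgr _ _ _ _ (cst 0)
      (fun t => M `^ theta * t `^ (- ((1 - alpha) * theta)))).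
  - near=> t; rewrite powR_ge0/= -mulNr powRrM -powRM ?powR_ge0 ?(ltW M0)//.
    apply: ge0_ler_powR; rewrite ?nnegrE ?mulr_ge0 ?powR_ge0 ?(ltW M0) ?(ltW theta0)//.
      by apply: F_ge0; near: t; exact: (nbhs_pinfty_ge (num_real _)).
    by apply: FM; near: t; exact: (nbhs_pinfty_ge (num_real _)).
  - exact: cvg_cst.
  - rewrite -[X in _ --> X](mulr0 (M `^ theta)); apply: cvgM; first exact: cvg_cst.
    by apply: powRN_cvgy0; rewrite mulr_gt0.
have xcauchy : cauchy_ex (x @ +oo).
  move=> e e0; have eC : 0 < e / C by rewrite divr_gt0.
  have /cvgrPdist_lt/(_ _ eC) Fe := Fth_cvg0.
  near (pinfty_nbhs R) => s.
  have s1 : 1 < s by near: s; exact: (nbhs_pinfty_gt (num_real _)).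
  exists (x s).
  have Fs : F s `^ theta < e / C.
    have : `|0 - F s `^ theta| < e / C by near: s.
    by rewrite sub0r normrN ger0_norm ?powR_ge0.
  suff : \forall t \near +oo, ball (x s) e (x t) by [].
  near=> t; rewrite -ball_normE/= distrC.
  apply: (@le_lt_trans _ _ (C * F s `^ theta)).
    by apply: xF => //; near: t; exact: (nbhs_pinfty_ge (num_real _)).
  by rewrite mulrC -ltr_pdivlMr.
have /cauchy_exP/cauchy_cvgP/cvg_ex[/= xinf xl] := xcauchy.
(* Let the later time in [xF] tend to infinity. *)
have xrate t : 1 < t -> `|x t - xinf| <= C * F t `^ theta.
  move=> t1; rewrite distrC.
  have xn : `|x s - x t| @[s --> +oo] --> `|xinf - x t|.
    by apply: cvg_norm; apply: cvgB => //; exact: cvg_cst.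
  apply: (closed_cvg (fun z => z <= C * F t `^ theta) _ _ _ xn); first exact: closed_le.
  by near=> s; apply: xF => //; near: s; exact: (nbhs_pinfty_ge (num_real _)).
exists xinf; split.
- split.
    apply: (closed_cvg _ clQ _ _ xl); near=> t; apply: xin.
    by near: t; exact: (nbhs_pinfty_ge (num_real _)).
  have fx : f (x t) @[t --> +oo] --> f xinf.
    by apply: (@continuous_cvg _ _ _ _ _ x f) => //; exact: differentiable_continuous.
  apply/eqP; rewrite -subr_eq0; apply/eqP; apply: (cvg_unique _ _ F_cvg0); first exact: norm_hausdorff.
  by apply: cvgB => //; exact: cvg_cst.
- exact: xl.
(* Here b = 1 - 2 theta, so that 1 + b = 2 - 2 theta. *)
- move=> th12; have b0 : 0 < 1 - 2 * theta by lra.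
  have [] := @power_decay _ K alpha 1 F y K0 alpha01 ler01 (fun t t1 => Fgt0 t (gt0 t t1))
    (fun t t1 => FP t (gt0 t t1)) (1 - 2 * theta) c b0 c0.
    move=> t t1; apply: le_trans (cy _ t1).
    by rewrite addrA.
  move=> N N0 FN; split.
    apply: (@bigO_pinfty _ _ _ (C * N `^ theta) 2) => [|t t2].
      by rewrite mulr_gt0// powR_gt0.
    have t1 : 1 < t by apply: lt_le_trans t2; rewrite ltr1n.
    rewrite normr_id ger0_norm ?powR_ge0//; apply: le_trans (xrate _ t1) _.
    rewrite -[leRHS]mulrA ler_pM2l// mulrAC -mulNr powRrM -powRM ?powR_ge0 ?(ltW N0)//.
    apply: ge0_ler_powR; rewrite ?nnegrE ?mulr_ge0 ?powR_ge0 ?(ltW N0) ?(ltW theta0)//.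
      by rewrite F_ge0// ltW// gt0.
    exact: FN.
  apply: (@bigO_pinfty _ _ _ N 2) => // t t2.
  have t1 : 1 < t by apply: lt_le_trans t2; rewrite ltr1n.
  rewrite -/(F t) !ger0_norm ?powR_ge0//; first exact: FN.
  by rewrite F_ge0// ltW// gt0.
- move=> thE.
  have [] := @exp_decay _ K alpha 1 F y ler01 (fun t t1 => Fgt0 t (gt0 t t1))
    (fun t t1 => FP t (gt0 t t1)) c.
    move=> t t1; apply: le_trans (cy _ t1).
    have Ft0 : 0 < F t by exact/Fgt0/gt0.
    rewrite (_ : 2 - 2 * theta = 1); first by rewrite powRr1// ltW.
    by rewrite thE; field.
  (* F decays with exponent c, but the distance is controlled by F^(1/2), which halves the
     exponent. *)
  move=> N N0 FN; exists (c / 2); first by rewrite divr_gt0.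
  have G0 t : 0 <= Gamma K alpha t by exact: Gamma_ge0.
  split.
    apply: (@bigO_pinfty _ _ _ (C * N `^ theta) 2) => [|t t2].
      by rewrite mulr_gt0// powR_gt0.
    have t1 : 1 < t by apply: lt_le_trans t2; rewrite ltr1n.
    rewrite normr_id ger0_norm ?expR_ge0//; apply: le_trans (xrate _ t1) _.
    rewrite -[leRHS]mulrA ler_pM2l// mulrAC -mulNr expRM -thE -powRM ?expR_ge0 ?(ltW N0)//.
    apply: ge0_ler_powR; rewrite ?nnegrE ?mulr_ge0 ?expR_ge0 ?(ltW N0) ?(ltW theta0)//.
      by rewrite F_ge0// ltW// gt0.
    exact: FN.
  apply: (@bigO_pinfty _ _ _ N 2) => // t t2.
  have t1 : 1 < t by apply: lt_le_trans t2; rewrite ltr1n.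
  rewrite -/(F t) !ger0_norm ?expR_ge0//; last by rewrite F_ge0// ltW// gt0.
  apply: le_trans (FN _ t2) _; rewrite ler_pM2l// ler_expR lerN2.
  by rewrite ler_wpM2r// ler_pdivrMr// ler_peMr ?(ltW c0)// ler1n.
Unshelve. all: by end_near. Qed.
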